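(* Let $\Sigma^+$ be a topologically mixing one-sided countable Markov shift with finite Gurevich entropy. Let $\phi,\psi:\Sigma^+\to\mathbb R$ have summable variations with $\sup\phi<\infty$ and $\|\psi\|_\infty<\infty$, and let $\mathfrak p_{\phi,\psi}(t):=P_G(\phi+t\psi)$, $t\in\mathbb R$. Then: (1) $\mathfrak p_{\phi,\psi}$ is finite, convex and continuous on $\mathbb R$. (2) $\mathfrak p_{\phi,\psi}$ has well-defined finite one-sided derivatives $(D^\pm\mathfrak p_{\phi,\psi})(t)=\lim_{h\to0^\pm}\frac1h[\mathfrak p_{\phi,\psi}(t+h)-\mathfrak p_{\phi,\psi}(t)]$. (3) $\lim_{t\to\infty}(D^\pm\mathfrak p_{\phi,\psi})(t)$ exist, are equal and finite; call the common value $\mathfrak p'_{\phi,\psi}(+\infty)$. Similarly $\lim_{t\to-\infty}(D^\pm\mathfrak p_{\phi,\psi})(t)$ exist, are equal and finite; call it $\mathfrak p'_{\phi,\psi}(-\infty)$. (4) $\mathfrak p'_{\phi,\psi}(+\infty)=\sup\{\int\psi d\mu:\mu\in\mathscr M(\Sigma^+)\}$ and $\mathfrak p'_{\phi,\psi}(-\infty)=\inf\{\int\psi d\mu:\mu\in\mathscr M(\Sigma^+)\}$. (5) If $\psi$ is not cohomologous to a constant by a continuous transfer function, then $\mathfrak p'_{\phi,\psi}(-\infty)<\mathfrak p'_{\phi,\psi}(+\infty)$.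
   Context: One-sided TMS over a countable directed graph with vertices $S$: $\Sigma^+=\{(x_0,x_1,\dots):x_i\to x_{i+1}\}$, left shift $\sigma$; mixing: strongly connected graph with gcd of loop lengths 1. $\mathrm{osc}_n(\phi)=\sup\{|\phi(\underline x)-\phi(\underline y)|:x_i=y_i,i<n\}$; summable variations: $\sum_{n\ge2}\mathrm{osc}_n(\phi)<\infty$. $\phi_n=\sum_{k<n}\phi\circ\sigma^k$; Gurevich pressure $P_G(\phi)=\lim\frac1n\log\sum_{\sigma^n\underline x=\underline x}e^{\phi_n(\underline x)}1_{[a]}(\underline x)$ for any state $a$; Gurevich entropy $P_G(0)$. $\mathscr M(\Sigma^+)$: shift-invariant Borel probability measures. $\psi$ cohomologous to a constant $c$ via a continuous transfer function means $\psi=r-r\circ\sigma+c$ for some continuous $r$. *)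

(* Defs.v *)
From HB Require Import structures.
From mathcomp Require Import all_boot all_order all_algebra.
From mathcomp Require Import all_classical all_reals all_analysis.
Set Implicit Arguments. Unset Strict Implicit. Unset Printing Implicit Defensive.
Import Order.TTheory GRing.Theory Num.Theory.
Import numFieldNormedType.Exports.
Local Open Scope classical_set_scope.
Local Open Scope ring_scope.

Section CMS.
(* Vertex set S (countability is a hypothesis of the theorem), edge relation E. *)
Context {S : pointedType} (E : S -> S -> Prop).

Definition walk (a b : S) (n : nat) : Prop :=
  exists w : nat -> S, w 0%N = a /\ w n = b /\ forall i, (i < n)%N -> E (w i) (w i.+1).

Definition strongly_connected : Prop := forall a b, exists n, walk a b n.

Definition aperiodic : Prop :=
  forall d : nat, (forall a n, (0 < n)%N -> walk a a n -> (d %| n)%N) -> d = 1%N.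

Definition mixing : Prop := strongly_connected /\ aperiodic.

Definition Sigma : set (nat -> S) := [set x | forall i, E (x i) (x i.+1)].

Definition shift (x : nat -> S) : nat -> S := fun i => x i.+1.

Context {R : realType}.

Definition bsum (phi : (nat -> S) -> R) (n : nat) (x : nat -> S) : R :=
  \sum_(k < n) phi (iter k shift x).

Definition osc (n : nat) (phi : (nat -> S) -> R) : \bar R :=
  ereal_sup [set r | exists x y, Sigma x /\ Sigma y /\
                      (forall i, (i < n)%N -> x i = y i) /\ r = (`|phi x - phi y|)%:E].

Definition summable_variations (phi : (nat -> S) -> R) : Prop :=
  exists M : R, forall N : nat, (\sum_(2 <= n < N) osc n phi <= M%:E)%E.

Definition Zn (phi : (nat -> S) -> R) (a : S) (n : nat) : \bar R :=
  \esum_(x in [set x | Sigma x /\ iter n shift x = x /\ x 0%N = a])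
     (expR (bsum phi n x))%:E.

(* Gurevich pressure (as limsup; the limit exists for mixing shifts) *)
Definition PG (phi : (nat -> S) -> R) (a : S) : \bar R :=
  limn_esup (fun n => ((n%:R)^-1)%:E * lne (Zn phi a n))%E.

(* cylinder sets; they generate the Borel sigma-algebra of S^N (S countable, discrete) *)
Definition cylinders : set (set (nat -> S)) :=
  [set A | exists (n : nat) (w : nat -> S), A = [set x | forall i, (i < n)%N -> x i = w i]].

Definition Omega := g_sigma_algebraType cylinders.

(* shift-invariant Borel probability measures on Sigma^+ (as measures on S^N carried by Sigma^+) *)
Definition invariant_probs : set (probability Omega R) :=
  [set mu | mu (Sigma : set Omega) = 1%E /\
            forall A : set Omega, measurable A -> mu (shift @^-1` A) = mu A].

Definition integrals (psi : (nat -> S) -> R) : set (\bar R) :=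
  [set (\int[mu]_(x in (Sigma : set Omega)) (psi x)%:E)%E | mu in invariant_probs].

(* continuity on Sigma^+ for the product (cylinder) topology *)
Definition continuous_on_Sigma (r : (nat -> S) -> R) : Prop :=
  forall x, Sigma x -> forall e : R, 0 < e -> exists n : nat, forall y, Sigma y ->
    (forall i, (i < n)%N -> y i = x i) -> `|r x - r y| < e.

Definition cohomologous_to_const (psi : (nat -> S) -> R) : Prop :=
  exists (r : (nat -> S) -> R) (c : R), continuous_on_Sigma r /\
    forall x, Sigma x -> psi x = r x - r (shift x) + c.

End CMS.

(* Main.v *)
(* Every quantity is governed by the averages [bsum psi n z / n] over periodic
   points [z] through [a].  The one-sided derivatives of the convex Lipschitz
   function [p] tend at +oo to its recession slope.  Summing over periodic points,
   [p t <= p 0 + t * b] for [t >= 0] as soon as all these averages are at most [b],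
   while one periodic orbit already gives [p t >= const + t * average]; so the
   slope is the supremum of the averages.

   Periodic orbits carry invariant measures, so this supremum is at most the
   supremum of the integrals.  Conversely, an orbit segment whose two ends have
   their first coordinate in a finite set of states can be closed up into a
   periodic orbit through [a] at bounded cost.  By tightness the other segments
   have small measure, and integrating the resulting pointwise bound on
   [bsum psi n] bounds [\int psi] by the supremum of the averages.

   If the two slopes agree, [psi] has constant periodic averages and Livsic's
   argument applies.  *)

Require Import Defs.
From HB Require Import structures.
From mathcomp Require Import all_boot all_order all_algebra.
From mathcomp Require Import all_classical all_reals all_analysis.
From mathcomp Require Import measurable_realfun.
From mathcomp Require Import ring lra zify.
Import Order.TTheory GRing.Theory Num.Theory.
Import numFieldNormedType.Exports.
Local Open Scope classical_set_scope.
Local Open Scope ring_scope.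
Set Implicit Arguments.
Unset Strict Implicit.
Unset Printing Implicit Defensive.

Local Notation shift := Defs.shift.

(** * One-sided derivatives of convex functions and their limits at infinity *)

Section ConvexFunctions.
Variable R : realType.
Implicit Types (p : R -> R) (t h : R).

Definition convex_fun p := forall x y l : R, 0 <= l <= 1 ->
  p (l * x + (1 - l) * y) <= l * p x + (1 - l) * p y.

Definition diff_quot p t h : R := h^-1 * (p (t + h) - p t).

Lemma diff_quot_opp p t h :
  diff_quot (p \o -%R) (- t) (- h) = - diff_quot p t h.
Proof. by rewrite /diff_quot /= -opprD !opprK invrN mulNr. Qed.

Lemma convex_fun_opp p : convex_fun p -> convex_fun (p \o -%R).
Proof.
move=> cp x y l l01 /=.
have := cp (- x) (- y) l l01; congr (p _ <= _); ring.
Qed.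

Lemma convex_three_chords p x y z : convex_fun p -> x < y -> y < z ->
  (z - x) * p y <= (z - y) * p x + (y - x) * p z.
Proof.
move=> cp xy yz; have xz : 0 < z - x by lra.
pose l := (z - y) / (z - x).
have l01 : 0 <= l <= 1.
  apply/andP; split; first by apply: divr_ge0; lra.
  by rewrite ler_pdivrMr // mul1r; lra.
have := cp x z l l01.
have -> : l * x + (1 - l) * z = y by rewrite /l; field; rewrite gt_eqF.
rewrite -(ler_pM2l xz) => /le_trans; apply.
rewrite le_eqVlt; apply/orP; left; apply/eqP; rewrite /l; field.
by rewrite gt_eqF.
Qed.

(** The sign patterns of [h] and [k] correspond to the orderings of [t], [t + h] and [t + k]; each
    is the three-chord inequality for that ordering. *)
Lemma diff_quot_le p t h k : convex_fun p -> h != 0 -> k != 0 -> h <= k ->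
  diff_quot p t h <= diff_quot p t k.
Proof.
move=> cp h0 k0; rewrite le_eqVlt => /predU1P[->//|hk].
rewrite /diff_quot.
have [hp|hn|/eqP] := ltgtP 0 h; last by rewrite eq_sym (negbTE h0).
- have kp : 0 < k by apply: lt_trans hk.
  have := @convex_three_chords p t (t + h) (t + k) cp.
  have -> : t + k - t = k by ring.
  have -> : t + h - t = h by ring.
  move=> /(_ ltac:(lra) ltac:(lra)) H.
  rewrite ![_^-1 * _]mulrC ler_pdivrMr // mulrAC ler_pdivlMr //; nra.
have [kp|kn|/eqP] := ltgtP 0 k; last by rewrite eq_sym (negbTE k0).
- have := @convex_three_chords p (t + h) t (t + k) cp.
  move=> /(_ ltac:(lra) ltac:(lra)) H.
  rewrite ![_^-1 * _]mulrC ler_ndivrMr // mulrAC ler_pdivrMr //; nra.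
have := @convex_three_chords p (t + h) (t + k) t cp.
move=> /(_ ltac:(lra) ltac:(lra)) H.
rewrite ![_^-1 * _]mulrC ler_ndivrMr // mulrAC ler_ndivrMr //; nra.
Qed.

(** The quotient is monotone in [h] and bounded below by its value at [-1], so its right limit is an
    infimum; the last two clauses keep that description. *)
Lemma convex_right_derivative p t : convex_fun p -> exists d : R,
  [/\ diff_quot p t h @[h --> 0^'+] --> d,
      forall h, 0 < h -> d <= diff_quot p t h &
      forall c, (forall h, 0 < h -> c <= diff_quot p t h) -> c <= d].
Proof.
move=> cp; set A := diff_quot p t @` [set` `]0, +oo[].
have A0 : A !=set0 by exists (diff_quot p t 1), 1 => //=; rewrite in_itv/= ltr01.
have lbA : has_lbound A.
  exists (diff_quot p t (-1)) => _ [h + <-].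
  rewrite /= in_itv/= andbT => h0.
  by apply: diff_quot_le; rewrite ?oppr_eq0 ?oner_eq0 ?gt_eqF //; lra.
exists (inf A); split.
- apply: (@nondecreasing_at_right_cvgr R _ 0 (BInfty R false)) => //.
  move=> h k; rewrite !in_itv /= !andbT => h0 k0 hk.
  by apply: diff_quot_le; rewrite ?gt_eqF.
- by move=> h h0; apply: ge_inf => //; exists h; rewrite //= in_itv/= h0.
- move=> c cA; apply: lb_le_inf => // _ [h + <-].
  by rewrite /= in_itv/= andbT; exact: cA.
Qed.

Lemma convex_left_derivative p t : convex_fun p -> exists d : R,
  [/\ diff_quot p t h @[h --> 0^'-] --> d,
      forall h, h < 0 -> diff_quot p t h <= d &
      forall c, (forall h, h < 0 -> diff_quot p t h <= c) -> d <= c].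
Proof.
move=> /convex_fun_opp cp.
have [d [dcvg dle dge]] := convex_right_derivative (- t) cp.
exists (- d); split.
- apply/cvg_at_leftNP; rewrite oppr0.
  rewrite (_ : _ \o _ = -%R \o diff_quot (p \o -%R) (- t)).
    exact: cvgN.
  by apply/funext => h /=; rewrite -{2}(opprK h) diff_quot_opp opprK.
- move=> h h0; rewrite -(opprK (diff_quot _ _ _)) lerN2 -diff_quot_opp.
  by apply: dle; rewrite oppr_gt0.
- move=> c ch; rewrite lerNl; apply: dge => h h0.
  rewrite -(opprK h) diff_quot_opp lerN2; apply: ch.
  by rewrite oppr_lt0.
Qed.

(** Order-theoretic form of the right derivative, free of limits, so that it passes through the
    reflection [t -> -t] by inequalities alone. *)
Definition right_slope p (D : R -> R) :=
  (forall t h, 0 < h -> D t <= diff_quot p t h) /\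
  (forall t c, (forall h, 0 < h -> c <= diff_quot p t h) -> c <= D t).

Definition left_slope p (D : R -> R) :=
  (forall t h, h < 0 -> diff_quot p t h <= D t) /\
  (forall t c, (forall h, h < 0 -> diff_quot p t h <= c) -> D t <= c).

Lemma right_slope_opp p D : left_slope p D ->
  right_slope (p \o -%R) (fun t => - D (- t)).
Proof.
move=> [D1 D2]; split => [t h h0|t c ch].
  rewrite -(opprK t) -(opprK h) diff_quot_opp opprK lerN2.
  by apply: D1; rewrite oppr_lt0.
rewrite lerNr; apply: D2 => h h0.
by rewrite lerNr -diff_quot_opp opprK; apply: ch; rewrite oppr_gt0.
Qed.

Lemma left_slope_opp p D : right_slope p D ->
  left_slope (p \o -%R) (fun t => - D (- t)).
Proof.
move=> [D1 D2]; split => [t h h0|t c ch].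
  rewrite -(opprK t) -(opprK h) diff_quot_opp opprK lerN2.
  by apply: D1; rewrite oppr_gt0.
rewrite lerNl; apply: D2 => h h0.
by rewrite lerNl -diff_quot_opp opprK; apply: ch; rewrite oppr_lt0.
Qed.

Lemma diff_quot_sym p t s : t != s ->
  diff_quot p t (s - t) = diff_quot p s (t - s).
Proof.
move=> ts; rewrite /diff_quot.
have -> : t + (s - t) = s by ring.
have -> : s + (t - s) = t by ring.
by field; rewrite !subr_eq0 ts eq_sym ts.
Qed.

(* The one-sided derivatives at infinity are the recession slope of [p]: the
   least [b] such that [p] stays below the line of slope [b] through [p 0]. *)
Lemma slope_at_infinity p Dp Dm (M : R) : convex_fun p ->
  (forall t h, h != 0 -> diff_quot p t h <= M) ->
  right_slope p Dp -> left_slope p Dm ->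
  exists L : R, [/\ Dp t @[t --> +oo] --> L, Dm t @[t --> +oo] --> L,
    forall t, 0 <= t -> p t <= p 0 + t * L &
    forall b, (forall t, 0 <= t -> p t <= p 0 + t * b) -> L <= b].
Proof.
move=> cp pM [Dp1 Dp2] [Dm1 Dm2].
have DmDp t : Dm t <= Dp t.
  apply: Dm2 => h h0; apply: Dp2 => k k0.
  apply: (diff_quot_le _ cp (ltr0_neq0 h0) (lt0r_neq0 k0)).
  exact: ltW (lt_trans h0 k0).
have Dpq t s : t < s -> Dp t <= diff_quot p t (s - t).
  by move=> ts; apply: Dp1; lra.
have Dmq t s : t < s -> diff_quot p t (s - t) <= Dm s.
  by move=> ts; rewrite diff_quot_sym ?lt_eqF //; apply: Dm1; lra.
(* With [DmDp], the two derivatives interlace, so their suprema coincide. *)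
have DpDm t s : t < s -> Dp t <= Dm s.
  by move=> ts; apply: le_trans (Dpq _ _ ts) (Dmq _ _ ts).
have ndp : nondecreasing_fun Dp.
  move=> t s; rewrite le_eqVlt => /predU1P[->//|ts].
  exact: le_trans (DpDm _ _ ts) (DmDp s).
have ndm : nondecreasing_fun Dm.
  move=> t s; rewrite le_eqVlt => /predU1P[->//|ts].
  exact: le_trans (DmDp t) (DpDm _ _ ts).
have DpM t : Dp t <= M.
  by apply: le_trans (Dp1 t 1 ltr01) (pM _ _ _); rewrite oner_eq0.
have ubp : has_ubound (range Dp) by exists M => _ [t _ <-].
have ubm : has_ubound (range Dm).
  by exists M => _ [t _ <-]; exact: le_trans (DmDp t) (DpM t).
have Lle t : Dp t <= sup (range Dp) by apply: ub_le_sup => //; exists t.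
exists (sup (range Dp)); split.
- exact: nondecreasing_cvgr.
- rewrite (_ : sup (range Dp) = sup (range Dm)); first exact: nondecreasing_cvgr.
  apply/eqP; rewrite eq_le; apply/andP; split; apply: ge_sup.
  + by exists (Dp 0), 0.
  + move=> _ [t _ <-]; apply: le_trans (DpDm t (t + 1) _) _; first by lra.
    by apply: ub_le_sup => //; exists (t + 1).
  + by exists (Dm 0), 0.
  + by move=> _ [t _ <-]; apply: le_trans (DmDp t) (Lle t).
- move=> t; rewrite le_eqVlt => /predU1P[<-|t0]; first by rewrite mul0r addr0.
  have := le_trans (le_trans (Dmq 0 t t0) (DmDp t)) (Lle t).
  rewrite /diff_quot subr0 add0r mulrC ler_pdivrMr //; lra.
- move=> b pb; apply: ge_sup; first by exists (Dp 0), 0.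
  move=> _ [t _ <-]; rewrite leNgt; apply/negP => bD.
  (* [C] is the gap at [t] between the line of slope [b] and [p]. From [t] on, [p] grows at rate at
     least [b + e], so an increment larger than [C / e] closes the gap; the summand [|t|] keeps
     [t + h] nonnegative. *)
  pose C := p 0 + t * b - p t; pose e := Dp t - b.
  have e0 : 0 < e by rewrite /e; lra.
  pose h := `|t| + `|C| / e + 1.
  have Ce : 0 <= `|C| / e by rewrite divr_ge0 // ltW.
  have t0 := normr_ge0 t.
  have h0 : 0 < h by rewrite /h; lra.
  have th : 0 <= t + h by have := ler_norm (- t); rewrite normrN /h; lra.
  have := Dp1 t h h0; rewrite /diff_quot mulrC ler_pdivlMr // => H1.
  have := pb _ th => H2.
  have : h * e <= C by rewrite /e /C; lra.
  have : h * e = `|t| * e + `|C| + e by rewrite /h; field; rewrite gt_eqF.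
  have := ler_norm C; have : 0 <= `|t| * e by rewrite mulr_ge0 // ltW.
  by lra.
Qed.

(** The Lipschitz constant bounds every difference quotient. The behaviour at -oo is that of the
    reflected function at +oo, with the sign of the slope reversed. *)
Lemma convex_derivatives p (M : R) : convex_fun p ->
  (forall t s, `|p t - p s| <= `|t - s| * M) ->
  exists Dp Dm : R -> R,
    (forall t, diff_quot p t h @[h --> 0^'+] --> Dp t) /\
    (forall t, diff_quot p t h @[h --> 0^'-] --> Dm t) /\
  exists Lp Lm : R,
    [/\ Dp t @[t --> +oo] --> Lp, Dm t @[t --> +oo] --> Lp,
      Dp t @[t --> -oo] --> Lm & Dm t @[t --> -oo] --> Lm] /\
    [/\ forall t, 0 <= t -> p t <= p 0 + t * Lp,
        forall b, (forall t, 0 <= t -> p t <= p 0 + t * b) -> Lp <= b,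
        forall t, t <= 0 -> p t <= p 0 + t * Lm &
        forall b, (forall t, t <= 0 -> p t <= p 0 + t * b) -> b <= Lm].
Proof.
move=> cp lip.
have qM t h : h != 0 -> `|diff_quot p t h| <= M.
  move=> h0; rewrite /diff_quot normrM normfV mulrC ler_pdivrMr ?normr_gt0 //.
  by have := lip (t + h) t; rewrite mulrC (_ : t + h - t = h) //; ring.
have qM' t h : h != 0 -> diff_quot p t h <= M.
  by move=> /(qM t); apply: le_trans; exact: ler_norm.
have [Dp HDp] := choice (fun t => convex_right_derivative t cp).
have [Dm HDm] := choice (fun t => convex_left_derivative t cp).
have rp : right_slope p Dp by split => t; have [_ ? ?] := HDp t.
have lm : left_slope p Dm by split => t; have [_ ? ?] := HDm t.
exists Dp, Dm; split; first by move=> t; have [] := HDp t.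
split; first by move=> t; have [] := HDm t.
have [Lp [Lp1 Lp2 Lp3 Lp4]] := slope_at_infinity cp qM' rp lm.
have qMo t h : h != 0 -> diff_quot (p \o -%R) t h <= M.
  move=> h0; rewrite -(opprK t) -(opprK h) diff_quot_opp.
  by rewrite (le_trans (ler_norm _)) // normrN qM // oppr_eq0.
have [L [L1 L2 L3 L4]] := slope_at_infinity (convex_fun_opp cp) qMo
  (right_slope_opp lm) (left_slope_opp rp).
rewrite /= oppr0 in L3 L4.
exists Lp, (- L); split; split => //.
- by apply/cvgNy_compNP; apply/cvgNP; rewrite opprK.
- by apply/cvgNy_compNP; apply/cvgNP; rewrite opprK.
- move=> t t0; have := L3 (- t); rewrite opprK oppr_ge0 => /(_ t0); lra.
- move=> b Hb; rewrite lerNr; apply: L4 => t t0.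
  by have := Hb (- t); rewrite oppr_le0 => /(_ t0); lra.
Qed.

End ConvexFunctions.

(** * Paths, periodic points, Birkhoff sums and their distortion *)

Section BirkhoffSums.
Variables (S : pointedType) (E : S -> S -> Prop).
Implicit Types (x y z : nat -> S).

Definition periodic_at (a : S) (n : nat) : set (nat -> S) :=
  [set x | Sigma E x /\ iter n shift x = x /\ x 0%N = a].

Lemma iter_shiftE n x i : iter n shift x i = x (i + n)%N.
Proof. by elim: n i => [|n IH] i /=; rewrite ?addn0 // /shift IH addSnnS. Qed.

Lemma Sigma_shift x : Sigma E x -> Sigma E (shift x).
Proof. by move=> Sx i; exact: Sx. Qed.

Lemma Sigma_iter n x : Sigma E x -> Sigma E (iter n shift x).
Proof. by move=> Sx; elim: n => //= n; exact: Sigma_shift. Qed.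

(** The edges of [w] are required index by index, so that one concatenation serves both finite walks
    ([walk_glue]) and infinite paths ([prepend]). *)
Lemma glue n (u w : nat -> S) : u n = w 0%N ->
  (forall i, (i < n)%N -> E (u i) (u i.+1)) ->
  exists c : nat -> S, [/\ forall i, (i <= n)%N -> c i = u i,
    forall i, c (n + i)%N = w i &
    forall i, ((n <= i)%N -> E (w (i - n)%N) (w (i - n).+1)) -> E (c i) (c i.+1)].
Proof.
move=> uw Eu; exists (fun j => if (j <= n)%N then u j else w (j - n)%N).
split => [i -> //|i|i Ew].
  by case: i => [|i]; rewrite ?addn0 ?leqnn // addnS ltnNge leq_addr /= -addnS addKn.
have [ilt|ige] := ltnP i n; first by rewrite ltnW //; exact: Eu.
have := Ew ige; have [->|neq] := eqVneq i n; first by rewrite leqnn subSnn subnn uw.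
have -> : (i <= n)%N = false by lia.
by rewrite subSn.
Qed.

Lemma walk_glue n m (u w : nat -> S) : u n = w 0%N ->
  (forall i, (i < n)%N -> E (u i) (u i.+1)) ->
  (forall i, (i < m)%N -> E (w i) (w i.+1)) ->
  exists c : nat -> S, [/\ forall i, (i <= n)%N -> c i = u i,
    forall i, c (n + i)%N = w i &
    forall i, (i < n + m)%N -> E (c i) (c i.+1)].
Proof.
move=> uw Eu Ew; have [c [c1 c2 c3]] := glue uw Eu.
by exists c; split => // i inm; apply: c3 => ni; apply: Ew; lia.
Qed.

Lemma prepend n (u x : nat -> S) : u n = x 0%N ->
  (forall i, (i < n)%N -> E (u i) (u i.+1)) -> Sigma E x ->
  exists y, [/\ Sigma E y, iter n shift y = x &
    forall i, (i <= n)%N -> y i = u i].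
Proof.
move=> ux Eu Sx; have [y [y1 y2 y3]] := glue ux Eu.
exists y; split => //; first by move=> i; apply: y3 => _; exact: Sx.
by apply/funext => i; rewrite iter_shiftE addnC y2.
Qed.

Lemma loop_periodic (u : nat -> S) N : (0 < N)%N -> u N = u 0%N ->
  (forall i, (i < N)%N -> E (u i) (u i.+1)) ->
  exists2 z, periodic_at (u 0%N) N z & forall i, (i <= N)%N -> z i = u i.
Proof.
move=> N0 uN Eu; exists (fun i => u (i %% N)%N).
  split; last split; last by rewrite mod0n.
    move=> i; have iN := ltn_pmod i N0; have := Eu _ iN.
    congr (E _ _).
    have -> : (i.+1 %% N = (i %% N).+1 %% N)%N by rewrite -addn1 -modnDml addn1.
    have [|leN] := ltnP (i %% N).+1 N; first by move/modn_small ->.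
    have -> : (i %% N).+1 = N by apply/eqP; rewrite eqn_leq iN leN.
    by rewrite modnn uN.
  by apply/funext => i; rewrite iter_shiftE modnDr.
move=> i; rewrite leq_eqVlt => /predU1P[->|/modn_small -> //].
by rewrite modnn uN.
Qed.

(** The segment of [x] is framed by the two walks and the resulting loop is repeated. Agreement
    includes index [n], as the distortion bound [W 0] for [bsum f n] demands. *)
Lemma closing a x n l1 l2 : (0 < n)%N -> Sigma E x ->
  walk E a (x 0%N) l1 -> walk E (x n) a l2 ->
  exists2 z, periodic_at a (l1 + n + l2) z &
    forall i, (i <= n)%N -> z (l1 + i)%N = x i.
Proof.
move=> n0 Sx [u [u0 [ul Eu]]] [w [w0 [wl Ew]]].
have [c [c1 c2 c3]] := walk_glue ul Eu (fun i (_ : (i < n)%N) => Sx i).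
have cw : c (l1 + n)%N = w 0%N by rewrite c2 w0.
have [d [d1 d2 d3]] := walk_glue cw c3 Ew.
have d0 : d 0%N = a by rewrite d1 // c1.
have dN : d (l1 + n + l2)%N = d 0%N by rewrite d2 wl d0.
have [||z zper zd] := @loop_periodic d (l1 + n + l2) _ dN; first by lia.
  exact: d3.
exists z; first by rewrite -d0.
by move=> i le_in; rewrite zd ?d1 ?c2 //; lia.
Qed.

(** Strong connectedness is satisfied at [a] by the walk of length 0. If no loop had positive
    length, 2 would vacuously divide all loop lengths, against aperiodicity; a loop found anywhere
    is then joined to [a]. *)
Lemma mixing_has_loop a : mixing E -> exists2 n, (0 < n)%N & walk E a a n.
Proof.
move=> [sc ap].
have [b [n [n0 Wb]]] : exists b n, (0 < n)%N /\ walk E b b n.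
  apply: contrapT => H; suff : 2%N = 1%N by [].
  by apply: ap => b n n0 Wb; exfalso; apply: H; exists b, n.
have [l1 [u [u0 [ul Eu]]]] := sc a b; have [l2 [w [w0 [wl Ew]]]] := sc b a.
have [v [v0 [vn Ev]]] := Wb.
have uv : u l1 = v 0%N by rewrite ul v0.
have [c [c1 c2 c3]] := walk_glue uv Eu Ev.
have cw : c (l1 + n)%N = w 0%N by rewrite c2 vn w0.
have [d [d1 d2 d3]] := walk_glue cw c3 Ew.
exists (l1 + n + l2)%N; first by lia.
by exists d; rewrite d2 wl d1 // c1.
Qed.

Lemma mixing_has_periodic a : mixing E ->
  exists2 n, (0 < n)%N & periodic_at a n !=set0.
Proof.
move=> /(@mixing_has_loop a)[n n0 [u [u0 [un Eu]]]]; exists n => //.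
by have [|z + _] := loop_periodic n0 _ Eu; rewrite u0 ?un // => ?; exists z.
Qed.

Context {R : realType}.
Implicit Types (f g : (nat -> S) -> R).

Lemma bsumS f n x : bsum f n.+1 x = f x + bsum f n (shift x).
Proof.
rewrite /bsum big_ord_recl /=; congr (_ + _).
by apply: eq_bigr => i _; rewrite -iterSr.
Qed.

Lemma bsumSr f n x : bsum f n.+1 x = bsum f n x + f (iter n shift x).
Proof. by rewrite /bsum big_ord_recr. Qed.

Lemma bsum_cat f m n x : bsum f (m + n) x = bsum f m x + bsum f n (iter m shift x).
Proof.
elim: m x => [|m IH] x /=; first by rewrite /bsum big_ord0 add0r.
by rewrite addSn !bsumS IH addrA -iterSr.
Qed.

Lemma bsum_affine f g t n x :
  bsum (fun x => f x + t * g x) n x = bsum f n x + t * bsum g n x.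
Proof. by rewrite /bsum big_split /= mulr_sumr. Qed.

Lemma bsumN f n x : bsum (fun x => - f x) n x = - bsum f n x.
Proof. by rewrite /bsum sumrN. Qed.

Lemma bsum_cst (c : R) n x : bsum (fun=> c) n x = n%:R * c.
Proof. by rewrite /bsum sumr_const card_ord mulr_natl. Qed.

Lemma bsum_le f g n x : Sigma E x -> (forall y, Sigma E y -> f y <= g y) ->
  bsum f n x <= bsum g n x.
Proof. by move=> Sx fg; apply: ler_sum => i _; apply/fg/Sigma_iter. Qed.

Lemma bsum_bound f M n x : Sigma E x -> (forall y, Sigma E y -> `|f y| <= M) ->
  `|bsum f n x| <= n%:R * M.
Proof.
move=> Sx fM; apply: le_trans (ler_norm_sum _ _ _) _.
apply: (@le_trans _ _ (\sum_(k < n) M)).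
  by apply: ler_sum => i _; apply/fM/Sigma_iter.
by rewrite sumr_const card_ord mulr_natl.
Qed.

Lemma bsum_periodic f n x k : iter n shift x = x ->
  bsum f (k * n) x = k%:R * bsum f n x.
Proof.
move=> px; elim: k => [|k IH]; first by rewrite mul0n /bsum big_ord0 mul0r.
by rewrite mulSn bsum_cat px IH -natr1 mulrDl mul1r addrC.
Qed.

Lemma iter_periodic n x k : iter n shift x = x -> iter (k * n) shift x = x.
Proof. by move=> px; elim: k => // k IH; rewrite mulSn iterD IH. Qed.

(** Bounded distortion: the bound depends only on the agreement beyond the first [n] symbols, not on
    the number [n] of summands. The case [n = 1] is uniform continuity. *)
Definition modulus f (W : nat -> R) := W @ \oo --> (0 : R) /\
  forall n k x y, Sigma E x -> Sigma E y ->
    (forall i, (i < n + k.+1)%N -> x i = y i) ->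
    `|bsum f n x - bsum f n y| <= W k.

(** [W k] is the tail of the series of oscillations starting at [osc (k + 2)]: the last summands of
    the two Birkhoff sums are evaluated at points agreeing on [k + 2] symbols, the earlier ones on
    more. *)
Lemma summable_variations_modulus f : summable_variations E f ->
  exists W, modulus f W.
Proof.
move=> [M HM].
(* On an empty shift the oscillations are suprema of the empty set, hence not nonnegative; any
   modulus works there. *)
have [S0|] := pselect (exists x, Sigma E x); last first.
  move=> S0; exists (fun=> 0); split; first exact: cvg_cst.
  by move=> n k x y Sx; exfalso; apply: S0; exists x.
have [x0 Sx0] := S0.
have osc_ge n x y : Sigma E x -> Sigma E y -> (forall i, (i < n)%N -> x i = y i) ->
    (`|f x - f y|%:E <= osc E n f)%E.
  by move=> Sx Sy xy; apply: ereal_sup_ubound; exists x, y.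
have osc0 n : (0 <= osc E n f)%E.
  by have := osc_ge n x0 x0 Sx0 Sx0 (fun i _ => erefl); rewrite subrr normr0.
have oscS N : (\sum_(n < N) osc E n.+2 f <= M%:E)%E.
  apply: le_trans (HM N.+2); rewrite -[X in index_iota X _]add0n big_addn subn2.
  by rewrite big_mkord; under [leRHS]eq_bigr do rewrite addn2.
have oscf n : osc E n.+2 f \is a fin_num.
  rewrite ge0_fin_numE //; apply: le_lt_trans (ltry M).
  apply: le_trans (oscS n.+1); rewrite big_ord_recr /= leeDr //.
  exact: sume_ge0.
pose v n : R := fine (osc E n.+2 f).
have v0 n : 0 <= v n by apply: fine_ge0.
have sv N : series v N <= M.
  rewrite /series /= big_mkord -lee_fin -sumEFin; apply: le_trans (oscS N).
  by apply: lee_sum => i _; rewrite /v fineK.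
have ndv : nondecreasing_seq (series v) by apply: nondecreasing_series.
have cv : cvgn (series v).
  by apply: nondecreasing_is_cvgn => //; exists M => _ [n _ <-].
exists (fun k => limn (series v) - series v k); split.
  by rewrite -(subrr (limn (series v))); apply: cvgB => //; exact: cvg_cst.
suff H n k x y : Sigma E x -> Sigma E y ->
    (forall i, (i < n + k.+1)%N -> x i = y i) ->
    `|bsum f n x - bsum f n y| <= series v (n + k)%N - series v k.
  move=> n k x y Sx Sy xy; apply: le_trans (H n k x y Sx Sy xy) _.
  by rewrite lerD2r; apply: nondecreasing_cvgn_le.
elim: n x y => [|n IH] x y Sx Sy xy.
  by rewrite /bsum !big_ord0 !subrr normr0.
rewrite !bsumS opprD addrACA.
apply: le_trans (ler_normD _ _) _.
rewrite addSn seriesSr addrAC [leLHS]addrC; apply: lerD.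
  by apply: IH; [exact: Sigma_shift|exact: Sigma_shift|move=> i ?; apply: xy; lia].
rewrite /v -lee_fin fineK //; apply: osc_ge => // i ilt; apply: xy; lia.
Qed.

Lemma modulus_ge0 f W k : Sigma E !=set0 -> modulus f W -> 0 <= W k.
Proof.
move=> [x Sx] [_ /(_ 0%N k x x Sx Sx (fun i _ => erefl))].
by rewrite subrr normr0.
Qed.

Lemma modulusN f W : modulus f W -> modulus (fun x => - f x) W.
Proof.
move=> [W0 HW]; split=> // n k x y Sx Sy xy.
by rewrite !bsumN -opprD normrN; exact: HW.
Qed.

Lemma modulus_continuous f W : modulus f W -> continuous_on_Sigma E f.
Proof.
move=> [/cvgrPdist_lt W0 HW] x Sx e e0.
have [k _ /(_ k (leqnn k))/=] := W0 _ e0; rewrite sub0r normrN => Wk.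
exists k.+2 => y Sy xy; have := HW 1%N k x y Sx Sy.
rewrite /bsum !big_ord1 => /(_ (fun i ik => esym (xy i ik))) /le_lt_trans; apply.
by apply: le_lt_trans Wk; exact: ler_norm.
Qed.

End BirkhoffSums.

(** * Gurevich pressure through exponential bounds on partition functions *)

Section Pressure.
Context {R : realType} {S : pointedType} (E : S -> S -> Prop) (a : S).
Implicit Types (f g : (nat -> S) -> R).

Lemma lne_div_natl_le (n : nat) (Z : \bar R) (A : R) : (0 < n)%N ->
  ((n%:R^-1)%:E * lne Z <= A%:E)%E = (Z <= (expR (n%:R * A))%:E)%E.
Proof.
move=> n0; have n0' : (0 : R) < n%:R by rewrite ltr0n.
have ni : (0 : R) < n%:R^-1 by rewrite invr_gt0.
case: Z => [r| |] /=.
- case: ifPn => [r0|]; last rewrite -ltNge => r0.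
    by rewrite gt0_muleNy ?lte_fin // leNye lee_fin (le_trans r0) // expR_ge0.
  rewrite -EFinM !lee_fin mulrC ler_pdivrMr // [A * _]mulrC.
  by rewrite -[X in _ = (X <= _)](lnK r0) ler_expR.
- by rewrite gt0_muley ?lte_fin // !leye_eq.
- by rewrite gt0_muleNy ?lte_fin // !leNye.
Qed.

(** Together with [Zn_PG_le] this trades the limsup for eventual bounds. Only a strict inequality
    yields such a bound, hence the lemmas below assume [<] and conclude [<=]. *)
Lemma PG_lt_Zn f (A : R) : (PG E f a < A%:E)%E ->
  exists N, forall n, (N <= n)%N -> (0 < n)%N ->
    (Zn E f a n <= (expR (n%:R * A))%:E)%E.
Proof.
rewrite /PG /limn_esup limf_esupE => /ereal_inf_lt[_ [V [N _ NV] <-] VA].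
exists N => n Nn n0; rewrite -lne_div_natl_le //.
by apply: le_trans (ltW VA); apply: ereal_sup_ubound; exists n => //; exact: NV.
Qed.

Lemma Zn_PG_le f (A : R) N :
  (forall n, (N <= n)%N -> (0 < n)%N -> (Zn E f a n <= (expR (n%:R * A))%:E)%E) ->
  (PG E f a <= A%:E)%E.
Proof.
move=> H; rewrite /PG /limn_esup limf_esupE.
apply: (@le_trans _ _ (ereal_sup ((fun n : nat => (n%:R^-1)%:E * lne (Zn E f a n))%E
   @` [set n | (N.+1 <= n)%N]))).
  by apply: ereal_inf_lbound; exists [set n | (N.+1 <= n)%N] => //; exists N.+1.
apply: ge_ereal_sup => _ [n /= Nn <-].
have n0 : (0 < n)%N by apply: leq_trans Nn.
by rewrite lne_div_natl_le //; apply: H => //; exact: ltnW.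
Qed.

Lemma Zn_leP f n (c : R) : reflect
  (forall X, finite_set X -> X `<=` periodic_at E a n ->
     \sum_(x \in X) expR (bsum f n x) <= c)
  (Zn E f a n <= c%:E)%E.
Proof.
apply: (iffP idP) => [Zc X Xf XP|H].
  rewrite -lee_fin; apply: le_trans Zc; rewrite -fsumEFin //.
  by apply: ereal_sup_ubound; exists X.
apply: ge_ereal_sup => _ [X [Xf XP] <-].
by rewrite fsumEFin // lee_fin; exact: H.
Qed.

Lemma ler_fsum (T : choiceType) (X : set T) (u v : T -> R) : finite_set X ->
  (forall x, X x -> u x <= v x) -> \sum_(x \in X) u x <= \sum_(x \in X) v x.
Proof.
move=> Xf uv; rewrite -lee_fin -!fsumEFin //; exact: lee_fsum.
Qed.

(** Average the tangent-line inequality at the barycentre [m]. *)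
Lemma expR_convex (l u v : R) : 0 <= l <= 1 ->
  expR (l * u + (1 - l) * v) <= l * expR u + (1 - l) * expR v.
Proof.
move=> /andP[l0 l1]; set m := l * u + (1 - l) * v.
have tangent w : expR m * (1 + (w - m)) <= expR w.
  have -> : expR w = expR m * expR (w - m) by rewrite -expRD; congr expR; ring.
  by rewrite ler_pM2l ?expR_gt0 // expR_ge1Dx.
have -> : expR m = l * (expR m * (1 + (u - m))) + (1 - l) * (expR m * (1 + (v - m))).
  by rewrite /m; ring.
by apply: lerD; apply: ler_wpM2l => //; lra.
Qed.

Lemma PG_compare f g (c B : R) :
  (forall n x, (0 < n)%N -> periodic_at E a n x ->
     bsum f n x <= bsum g n x + n%:R * c) ->
  (PG E g a < B%:E)%E -> (PG E f a <= (B + c)%:E)%E.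
Proof.
move=> fg /PG_lt_Zn[N HN].
apply: (@Zn_PG_le _ _ N) => n Nn n0; apply/Zn_leP => X Xf XP.
have /Zn_leP/(_ X Xf XP) := HN n Nn n0.
rewrite mulrDr expRD -(ler_pM2r (expR_gt0 (n%:R * c))) => H.
apply: le_trans H; rewrite mulr_fsuml; apply: ler_fsum => // x xX.
by rewrite -expRD ler_expR; apply: fg => //; apply: XP.
Qed.

Lemma PG_convex f g (l A B : R) : 0 <= l <= 1 ->
  (PG E f a < A%:E)%E -> (PG E g a < B%:E)%E ->
  (PG E (fun x => l * f x + (1 - l) * g x)%R a <= (l * A + (1 - l) * B)%:E)%E.
Proof.
move=> l01 /PG_lt_Zn[N HN] /PG_lt_Zn[N' HN'].
apply: (@Zn_PG_le _ _ (maxn N N')) => n; rewrite geq_max => /andP[Nn Nn'] n0.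
apply/Zn_leP => X Xf XP.
have /Zn_leP/(_ X Xf XP) := HN n Nn n0; set sf := \sum_(x \in X) _ => Hf.
have /Zn_leP/(_ X Xf XP) := HN' n Nn' n0; set sg := \sum_(x \in X) _ => Hg.
pose eA := expR (n%:R * A); pose eB := expR (n%:R * B).
have eA0 : 0 < eA := expR_gt0 _; have eB0 : 0 < eB := expR_gt0 _.
set e := expR (n%:R * (l * A + (1 - l) * B)); have e0 : 0 < e := expR_gt0 _.
(* Young's inequality after normalising both weights by their growth rates *)
apply: (@le_trans _ _ (\sum_(x \in X)
    (e * l / eA * expR (bsum f n x) + e * (1 - l) / eB * expR (bsum g n x)))).
  apply: ler_fsum => // x Xx.
  have -> : bsum (fun x => l * f x + (1 - l) * g x) n x =
      n%:R * (l * A + (1 - l) * B) +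
      (l * (bsum f n x - n%:R * A) + (1 - l) * (bsum g n x - n%:R * B)).
    by rewrite /bsum big_split /= -!mulr_sumr; ring.
  rewrite expRD -/e -!mulrA -mulrDr ler_pM2l //.
  apply: le_trans (expR_convex _ _ l01) _.
  by rewrite !expRD !expRN -/eA -/eB [eA^-1 * _]mulrC [eB^-1 * _]mulrC.
rewrite fsbig_split //= -!mulr_fsumr -/sf -/sg.
have /andP[l0 l1] := l01.
rewrite -[leRHS](_ : e * l / eA * eA + e * (1 - l) / eB * eB = e); last first.
  by field; rewrite !gt_eqF.
have l1' : 0 <= 1 - l by lra.
by apply: lerD; apply: ler_wpM2l => //; rewrite ?mulr_ge0 ?invr_ge0 // ltW.
Qed.

(** Along multiples of [n], the repeated orbit is a single term of [Zn], growing exponentially at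
    the rate of its average; the limsup sees this subsequence. *)
Lemma PG_ge_periodic f n x : (0 < n)%N -> periodic_at E a n x ->
  ((bsum f n x / n%:R)%:E <= PG E f a)%E.
Proof.
move=> n0 [Sx [px x0]]; rewrite leNgt; apply/negP => PGlt.
have n0' : (0 : R) < n%:R by rewrite ltr0n.
have [A PGA Alt] : exists2 A : R, (PG E f a < A%:E)%E & A < bsum f n x / n%:R.
  case: (PG E f a) PGlt => [r| |] //; rewrite ?lte_fin => H.
  - exists ((r + bsum f n x / n%:R) / 2); rewrite ?lte_fin; lra.
  - by exists (bsum f n x / n%:R - 1); rewrite ?ltNyr //; lra.
have [N HN] := PG_lt_Zn PGA.
have := HN (N.+1 * n)%N; rewrite muln_gt0 n0 /= => /(_ _ isT).
have leN : (N <= N.+1 * n)%N by apply: leq_trans (leqnSn N) _; rewrite leq_pmulr.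
move=> /(_ leN) /Zn_leP /(_ [set x] (finite_set1 x)).
rewrite fsbig_set1 bsum_periodic // ler_expR => H.
have : N.+1%:R * bsum f n x <= (N.+1 * n)%:R * A.
  by apply: H => y ->; split=> //; split=> //; exact: iter_periodic.
rewrite natrM -mulrA ler_pM2l ?ltr0n // mulrC -ler_pdivrMr // => H'.
by move: Alt; rewrite ltNge H'.
Qed.

End Pressure.

(** * The function [t -> P_G(phi + t psi)] *)

Section PressureFunction.
Context {R : realType} {S : pointedType} (E : S -> S -> Prop) (a : S).
Variables (phi psi : (nat -> S) -> R) (Mphi Mpsi : R).
Hypothesis mixE : mixing E.
Hypothesis PG0 : (PG E (fun _ => 0%R : R) a < +oo)%E.
Hypothesis phiM : forall x, Sigma E x -> phi x <= Mphi.
Hypothesis psiM : forall x, Sigma E x -> `|psi x| <= Mpsi.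

Local Notation P t := (PG E (fun x => phi x + t * psi x) a).
Local Notation p := (fun t : R => fine (P t)).

(** A periodic orbit bounds the pressure below; comparison with the zero potential, whose pressure
    is not +oo, bounds it above. *)
Lemma pressure_fin_num t : P t \is a fin_num.
Proof.
rewrite fin_numE; apply/andP; split.
  have [n n0 [z zP]] := mixing_has_periodic a mixE.
  have := PG_ge_periodic (fun x => phi x + t * psi x) n0 zP.
  by case: (P t).
have [B PGB] : exists B : R, (PG E (fun _ => 0%R : R) a < B%:E)%E.
  case: (PG E _ a) PG0 => [r| |] // _; first by exists (r + 1); rewrite lte_fin; lra.
  by exists 0; rewrite ltNyr.
have := @PG_compare _ _ E a (fun x => phi x + t * psi x) _ (Mphi + `|t| * Mpsi) B _ PGB.
case: (P t) => // H; exfalso; have : (+oo <= (B + (Mphi + `|t| * Mpsi))%:E)%E.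
  apply: H => n x n0 [Sx _]; rewrite bsum_cst mulr0 add0r -(bsum_cst _ n x).
  apply: (bsum_le (E := E)) => // y Sy; apply: lerD; first exact: phiM.
  by apply: le_trans (ler_norm _) _; rewrite normrM ler_wpM2l // psiM.
by rewrite leye_eq.
Qed.

Lemma pressure_le t (A : R) : (P t <= A%:E)%E -> p t <= A.
Proof. by rewrite -(fineK (pressure_fin_num t)) lee_fin. Qed.

Lemma pressure_lt t (e : R) : 0 < e -> (P t < (p t + e)%:E)%E.
Proof. by move=> e0; rewrite -{1}(fineK (pressure_fin_num t)) lte_fin ltrDl. Qed.

(** The sign of [t - s] is left free: the same estimate gives the Lipschitz bound and, in the final
    theorem, the bounding lines on both half-lines. *)
Lemma pressure_compare s t c :
  (forall n x, (0 < n)%N -> periodic_at E a n x ->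
     (t - s) * bsum psi n x <= n%:R * c) -> p t <= p s + c.
Proof.
move=> H; apply/ler_addgt0Pr => e e0.
rewrite addrAC; apply: pressure_le; apply: PG_compare (pressure_lt s e0).
move=> n x n0 xP; rewrite !bsum_affine -addrA lerD2l.
by have := H n x n0 xP; lra.
Qed.

Lemma pressure_convex : convex_fun p.
Proof.
move=> s t l l01; apply/ler_addgt0Pr => e e0.
have addE (u v : R) : l * u + (1 - l) * v + e = l * (u + e) + (1 - l) * (v + e).
  by ring.
rewrite addE; apply: pressure_le.
rewrite (_ : (fun x => _) = fun x => l * (phi x + s * psi x)
    + (1 - l) * (phi x + t * psi x)); last by apply/funext => x; ring.
by apply: PG_convex => //; exact: pressure_lt.
Qed.

Lemma pressure_lipschitz s t : `|p s - p t| <= `|s - t| * Mpsi.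
Proof.
have H u v : p u <= p v + `|u - v| * Mpsi.
  apply: pressure_compare => n x n0 [Sx _].
  apply: le_trans (ler_norm _) _; rewrite normrM mulrCA ler_wpM2l //.
  exact: (bsum_bound n Sx psiM).
have H1 := H s t; have H2 := H t s; rewrite distrC in H2.
by rewrite ler_norml lerBlDl H1 andbT lerBrDl lerBlDr.
Qed.

Lemma pressure_ge_periodic n x t : (0 < n)%N -> periodic_at E a n x ->
  bsum phi n x / n%:R + t * (bsum psi n x / n%:R) <= p t.
Proof.
move=> n0 xP; have := PG_ge_periodic (fun x => phi x + t * psi x) n0 xP.
rewrite -(fineK (pressure_fin_num t)) lee_fin bsum_affine.
by rewrite mulrDl mulrA.
Qed.

End PressureFunction.

(** * Livsic's theorem: constant periodic averages give a continuous transfer function *)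

Section Livsic.
Context {R : realType} {S : pointedType} (E : S -> S -> Prop) (a : S).
Variables (f : (nat -> S) -> R) (W : nat -> R) (M c : R).
Hypothesis mixE : mixing E.
Hypothesis fW : modulus E f W.
Hypothesis fM : forall x, Sigma E x -> `|f x| <= M.
Hypothesis fper : forall n z, (0 < n)%N -> periodic_at E a n z ->
  bsum f n z = n%:R * c.

Let T n y : R := bsum f n y - n%:R * c.

Let A x : set R := [set v | exists n y,
  [/\ Sigma E y, iter n shift y = x, y 0%N = a & v = T n y]].

(* The supremum over backward branches satisfies [r x + f x - c <= r (shift x)]
   for free; the defect is nonnegative with zero periodic sums, hence vanishes on
   the dense set of periodic points. *)
Let r x : R := sup (A x).

Let A_neq0 x : Sigma E x -> A x !=set0.
Proof.
move=> Sx; have [l [u [u0 [ul Eu]]]] := mixE.1 a (x 0%N).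
have [y [Sy yx yu]] := prepend ul Eu Sx.
by exists (T l y), l, y; rewrite yu.
Qed.

(** Close a branch from [a] to [x] by a walk back to [a]. The periodic sum being exactly [c] times
    the period, [T] is at most the distortion plus the cost of the return walk, whose length depends
    on [x] alone. *)
Let A_ub x : Sigma E x -> has_ubound (A x).
Proof.
move=> Sx; have [l wl] := mixE.1 (x 0%N) a.
have [_ HW] := fW.
have W0 : 0 <= W 0%N by apply: (modulus_ge0 _ _ fW); exists x.
have M0 : 0 <= M by apply: le_trans (fM Sx).
have c0 := normr_ge0 c.
exists (W 0%N + l%:R * M + l%:R * `|c|) => _ [n [y [Sy yx y0 ->]]].
have lM : 0 <= l%:R * M by rewrite mulr_ge0.
have lc : 0 <= l%:R * `|c| by rewrite mulr_ge0.
case: n yx => [|n] yx; first by rewrite /T /bsum big_ord0 mul0r subr0; lra.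
have wa : walk E a (y 0%N) 0 by rewrite y0; exists (fun=> a).
have xn : x 0%N = y n.+1 by rewrite -yx iter_shiftE.
have [|z zP zy] := closing (ltn0Sn n) Sy wa (l2 := l); first by rewrite -xn.
have := fper _ zP; rewrite add0n => /(_ isT); rewrite bsum_cat => zsum.
have [Sz _] := zP.
have /ler_normlP[_ H1] : `|bsum f n.+1 y - bsum f n.+1 z| <= W 0%N.
  by apply: HW => // i; rewrite addn1 ltnS => /zy <-.
have /ler_normlP[H2 _] := bsum_bound l (Sigma_iter n.+1 Sz) fM.
have H3 : l%:R * c <= l%:R * `|c| by rewrite ler_wpM2l // ler_norm.
rewrite /T; move: zsum; rewrite natrD mulrDl; lra.
Qed.

(** A backward branch of [x] becomes one of [x'] by replacing its tail; the two sums then differ by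
    at most [W k]. *)
Let r_le k x x' : Sigma E x -> Sigma E x' ->
  (forall i, (i < k.+1)%N -> x i = x' i) -> r x <= r x' + W k.
Proof.
move=> Sx Sx' xx'; apply: ge_sup; first exact: A_neq0.
move=> _ [n [y [Sy yx y0 ->]]].
have yn i : y (n + i)%N = x i by rewrite -yx iter_shiftE addnC.
have yx' : y n = x' 0%N by rewrite -(addn0 n) yn xx'.
have [y' [Sy' y'x' y'y]] := prepend yx' (fun i _ => Sy i) Sx'.
have yn' i : y' (n + i)%N = x' i by rewrite -y'x' iter_shiftE addnC.
have : T n y' <= r x'.
  by apply: ub_le_sup; [exact: A_ub|exists n, y'; rewrite y'y].
suff /ler_normlP[_] : `|bsum f n y - bsum f n y'| <= W k by rewrite /T; lra.
apply: fW.2 => // i ink; have [le_in|lt_ni] := leqP i n; first by rewrite y'y.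
by rewrite -(subnKC (ltnW lt_ni)) yn yn' xx' //; lia.
Qed.

Let r_step x : Sigma E x -> r x + (f x - c) <= r (shift x).
Proof.
move=> Sx; rewrite -lerBrDr; apply: ge_sup; first exact: A_neq0.
move=> _ [n [y [Sy yx y0 ->]]]; rewrite lerBrDr.
apply: ub_le_sup; first by apply: A_ub; exact: Sigma_shift.
exists n.+1, y; split=> //=; first by rewrite yx.
by rewrite /T bsumSr yx -natr1; ring.
Qed.

Let g x : R := r (shift x) - r x - (f x - c).

Let g_ge0 x : Sigma E x -> 0 <= g x.
Proof. by move=> /r_step; rewrite /g; lra. Qed.

Let bsum_g n x : bsum g n x = r (iter n shift x) - r x - T n x.
Proof.
elim: n => [|n IH]; first by rewrite /T /bsum !big_ord0 mul0r !subrr.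
by rewrite bsumSr IH /g /T bsumSr -natr1 /=; ring.
Qed.

Let g_periodic n z i : periodic_at E a n z -> (i < n)%N ->
  g (iter i shift z) = 0.
Proof.
move=> zP lt_in; have [Sz [pz _]] := zP.
have := bsum_g n z; rewrite pz /T fper ?(leq_ltn_trans _ lt_in) // !subrr.
move=> /eqP; rewrite psumr_eq0 => [/allP|j _]; last first.
  by apply: g_ge0; exact: Sigma_iter.
by move=> /(_ (Ordinal lt_in)); rewrite mem_index_enum => /(_ isT)/eqP.
Qed.

Let g_eq0 x : Sigma E x -> g x = 0.
Proof.
move=> Sx; apply/eqP; rewrite eq_le g_ge0 // andbT.
have [/cvgrPdist_lt W0 HW] := fW.
apply/ler_addgt0Pr => e e0; rewrite add0r.
(* Replacing [x] by a point of a periodic orbit costs [W k] three times: for [r] at [shift x], for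
   [r] at [x] and for [f]. *)
have [|k _ /(_ k (leqnn k))/=] := W0 (e / 3); first by lra.
rewrite sub0r normrN => /(le_lt_trans (ler_norm _)) Wk.
have [l1 w1] := mixE.1 a (x 0%N); have [l2 w2] := mixE.1 (x k.+2) a.
have [z zP zx] := closing (ltn0Sn k.+1) Sx w1 w2.
have [Sz _] := zP; pose w := iter l1 shift z.
have Sw : Sigma E w := Sigma_iter l1 Sz.
have wx i : (i < k.+3)%N -> x i = w i.
  by rewrite ltnS => /zx <-; rewrite /w iter_shiftE addnC.
have gw : g w = 0 by apply: (g_periodic zP); lia.
have H1 : r (shift x) <= r (shift w) + W k.
  by apply: r_le; [exact: Sigma_shift|exact: Sigma_shift|move=> i ?; apply: wx; lia].
have H2 : r w <= r x + W k by apply: r_le => // i ?; rewrite wx //; lia.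
have /ler_normlP[H3 _] : `|f x - f w| <= W k.
  have := HW 1%N k x w Sx Sw; rewrite /bsum !big_ord1; apply => i ?.
  by apply: wx; lia.
by move: gw; rewrite /g; lra.
Qed.

Lemma livsic : cohomologous_to_const E f.
Proof.
(* [g = 0] says that [f] is [r] after the shift minus [r], plus [c], hence the sign. *)
exists (fun x => - r x), c; split; last first.
  by move=> x /g_eq0; rewrite /g; lra.
move=> x Sx e e0; have [/cvgrPdist_lt W0 _] := fW.
have [k _ /(_ k (leqnn k))/=] := W0 e e0.
rewrite sub0r normrN => /(le_lt_trans (ler_norm _)) Wk.
exists k.+1 => y Sy yx.
have H1 := r_le Sy Sx yx; have H2 := r_le Sx Sy (fun i ik => esym (yx i ik)).
by rewrite ltr_norml; apply/andP; split; lra.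
Qed.

End Livsic.

(** * Measurability for the sigma-algebra generated by cylinders *)

Section Measurability.
Context {S : pointedType} (E : S -> S -> Prop).
Variable code : S -> nat.
Hypothesis code_inj : injective code.
Local Notation T := (@Omega S).

Lemma measurable_cylinder n (w : T) :
  measurable ([set x | forall i, (i < n)%N -> x i = w i] : set T).
Proof. by apply: sub_sigma_algebra; exists n, w. Qed.

Lemma measurable_open (U : set T) :
  (forall x, U x -> exists n, forall y : T, (forall i, (i < n)%N -> y i = x i) -> U y) ->
  measurable U.
Proof.
(* Coding finite words by lists of natural numbers makes the union of cylinders below countable. *)
move=> oU; pose word (x : nat -> S) n := map code (mkseq x n).
have wordP (x y : nat -> S) n : word x n = word y n <-> forall i, (i < n)%N -> x i = y i.
  split=> [/(inj_map code_inj) xy i ilt|xy].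
    by have := congr1 (fun s => nth point s i) xy; rewrite !nth_mkseq.
  by congr map; apply/eq_in_map => i; rewrite mem_iota => /xy.
(* [V t] is either empty or the whole cylinder of the word coded by [t]. *)
pose V (t : seq nat) : set T :=
  [set x | word x (size t) = t /\ forall y, word y (size t) = t -> U y].
have -> : U = \bigcup_t V t.
  apply/seteqP; split => [x Ux|x [t _ [xt]]]; last exact.
  have [n xU] := oU x Ux; exists (word x n) => //.
  rewrite /V /= size_map size_mkseq; split=> // y /wordP; exact: xU.
apply: countable_bigcupT_measurable; first exact: countableP.
move=> t; have [->|/set0P[x [xt xU]]] := eqVneq (V t) set0.
  exact: measurable0.
rewrite (_ : V t = [set y | forall i, (i < size t)%N -> y i = x i]).
  exact: measurable_cylinder.
apply/seteqP; split=> y /=; first by move=> [yt _]; apply/wordP; rewrite yt xt.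
by move=> /wordP yx; split=> //; rewrite yx xt.
Qed.

Lemma measurable_Sigma : measurable (Sigma E : set T).
Proof.
have -> : Sigma E = \bigcap_i ([set x | E (x i) (x i.+1)] : set T).
  by apply/seteqP; split=> [x Sx i _|x Sx i]; [exact: Sx|exact: Sx].
apply: bigcapT_measurable => i; apply: measurable_open => x /= Ex.
by exists i.+2 => y yx; rewrite !yx.
Qed.

Lemma measurable_shift : measurable_fun setT (shift : T -> T).
Proof.
refine (@measurability _ _ T T setT shift (@cylinders S) erefl _) => _ [_ [n [w ->]] <-].
rewrite setTI; apply: measurable_open => x xw; exists n.+1 => y yx i ilt.
by rewrite /shift yx //; exact: xw.
Qed.

Lemma measurable_continuous_on {R : realType} (f : T -> R) :
  continuous_on_Sigma E f -> measurable_fun (Sigma E : set T) f.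
Proof.
move=> cf; apply: (measurability _ (RGenOInfty.measurableE R)).
move=> _ [_ [c ->] <-].
(* The superlevel set is only relatively open in [Sigma E]; [U] is open in the full space and has
   the same trace. *)
pose U : set T := [set x | exists n, forall y, Sigma E y ->
  (forall i, (i < n)%N -> y i = x i) -> c < f y].
have -> : (Sigma E : set T) `&` f @^-1` `]c, +oo[%classic = (Sigma E : set T) `&` U.
  apply/seteqP; split=> x [Sx] /=.
    rewrite in_itv /= andbT => cx; split=> //.
    have [|n xn] := cf x Sx (f x - c); first by rewrite subr_gt0.
    by exists n => y Sy /(xn y Sy) /ltr_normlP[_]; rewrite ltrD2l ltrN2.
  by move=> [n xn]; split=> //; rewrite in_itv /= andbT; exact: xn.
apply: measurableI; first exact: measurable_Sigma.
apply: measurable_open => x [n xn]; exists n => y yx; exists n => z Sz zy.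
by apply: xn => // i ilt; rewrite zy // yx.
Qed.

End Measurability.

(** * Integration against an invariant measure *)

Section InvariantMeasures.
Context {R : realType} {S : pointedType} (E : S -> S -> Prop).
Variable code : S -> nat.
Hypothesis code_inj : injective code.
Local Notation T := (@Omega S).
Local Notation Sig := (Sigma E : set T).
Variable mu : probability T R.
Hypothesis mu_inv : invariant_probs E mu.

Let mSig : measurable Sig := measurable_Sigma E code_inj.
Let mshift : measurable_fun setT (shift : T -> T) := measurable_shift code_inj.

Definition bounded_measurable (h : T -> R) := measurable_fun Sig h /\
  exists C, forall x, Sig x -> `|h x| <= C.

Lemma bounded_measurable_integrable h : bounded_measurable h ->
  mu.-integrable Sig (EFin \o h).
Proof.
move=> [mh [C hC]]; apply: measurable_bounded_integrable => //.
  by rewrite /= mu_inv.1 ltry.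
exists C; split; first exact: num_real.
by move=> y Cy x Sx; exact: le_trans (hC x Sx) (ltW Cy).
Qed.

Lemma bounded_measurableD h1 h2 : bounded_measurable h1 ->
  bounded_measurable h2 -> bounded_measurable (fun x => h1 x + h2 x).
Proof.
move=> [m1 [C1 H1]] [m2 [C2 H2]]; split; first exact: measurable_funD.
exists (C1 + C2) => x Sx; apply: le_trans (ler_normD _ _) _.
by apply: lerD; [exact: H1|exact: H2].
Qed.

Lemma bounded_measurableZ c h : bounded_measurable h ->
  bounded_measurable (fun x => c * h x).
Proof.
move=> [m [C H]]; split; first exact: measurable_funM.
by exists (`|c| * C) => x Sx; rewrite normrM ler_wpM2l // H.
Qed.

Lemma bounded_measurable_cst c : bounded_measurable (fun=> c).
Proof. by split; [exact: measurable_cst|exists `|c|]. Qed.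

Lemma bounded_measurable_shift h : bounded_measurable h ->
  bounded_measurable (fun x => h (shift x)).
Proof.
move=> [m [C H]]; split; last by exists C => x /Sigma_shift; exact: H.
apply: (measurable_comp mSig _ m); last exact: measurable_funTS.
by move=> _ [x Sx <-]; exact: Sigma_shift.
Qed.

(** Extend [h] by zero and change variables. The preimage [D] of [Sigma E] may be larger than
    [Sigma E], but only by a null set, since [mu] is carried by [Sigma E]. *)
Lemma Rintegral_shift h : bounded_measurable h ->
  \int[mu]_(x in Sig) h (shift x) = \int[mu]_(x in Sig) h x.
Proof.
move=> [mh [C hC]]; have [muS muI] := mu_inv.
pose h' : T -> R := h \_ Sig.
have mh' : measurable_fun setT h' := (measurable_restrictT h mSig).1 mh.
have h'C x : `|h' x| <= `|C|.
  rewrite /h' patchE; case: ifPn => [|_]; last by rewrite normr0.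
  by rewrite inE => /hC /le_trans; apply; exact: ler_norm.
pose D : set T := (shift : T -> T) @^-1` Sig.
have mD : measurable D.
  by rewrite -[X in measurable X]setTI; exact: mshift.
have int' : mu.-integrable D ((EFin \o h') \o (shift : T -> T)).
  apply: (@measurable_bounded_integrable _ _ _ _ (h' \o (shift : T -> T))) => //.
  - by have /= -> : mu D = 1%E; rewrite ?ltry // -muS; exact: muI.
  - by apply: measurable_funTS; exact: measurableT_comp.
  - exists `|C|; split; first exact: num_real.
    by move=> y Cy x _; exact: le_trans (h'C _) (ltW Cy).
congr fine.
transitivity (\int[pushforward mu (shift : T -> T)]_(x in Sig) (h' x)%:E)%E; last first.
  transitivity (\int[mu]_(x in Sig) (h' x)%:E)%E.
    pose sm := MeasurableFun.Pack (MeasurableFun.Class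
      (isMeasurableFun.Build _ _ _ _ _ mshift)).
    by apply: (eq_measure_integral mu (m1 := pushforward mu sm)) => A mA _; exact: muI.
  by apply: eq_integral => x xS; rewrite /h' patchE xS.
rewrite (integral_pushforward mshift) //; last exact/measurable_EFinP.
pose N : set T := D `\` Sig.
rewrite (negligible_integral (N := N)) //; last 2 first.
- exact: measurableD.
- apply: (@subset_measure0 _ _ _ mu _ (~` Sig)) => //.
  + exact: measurableD.
  + exact: measurableC.
  + by move=> x [].
  + by rewrite /= probability_setC // muS subee.
have -> : D `\` N = Sig.
  apply/seteqP; split=> x; rewrite /N setDD; first by case.
  by move=> Sx; split => //; exact: Sigma_shift.
apply: eq_integral => x; rewrite inE => Sx.
by rewrite /= /h' patchE ifT // inE; exact: Sigma_shift.
Qed.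

Lemma bounded_measurable_iter n h : bounded_measurable h ->
  bounded_measurable (fun x => h (iter n shift x)).
Proof.
move=> bh; elim: n => // n IH; under eq_fun do rewrite iterSr.
exact: (bounded_measurable_shift IH).
Qed.

Lemma Rintegral_iter n h : bounded_measurable h ->
  \int[mu]_(x in Sig) h (iter n shift x) = \int[mu]_(x in Sig) h x.
Proof.
move=> bh; elim: n => // n IH.
rewrite -IH -(Rintegral_shift (bounded_measurable_iter n bh)).
by apply: eq_Rintegral => x _; rewrite iterSr.
Qed.

Lemma bounded_measurable_bsum n h : bounded_measurable h ->
  bounded_measurable (bsum h n).
Proof.
move=> bh; elim: n => [|n IH].
  rewrite (_ : bsum h 0 = fun=> 0); first exact: bounded_measurable_cst.
  by apply/funext => x; rewrite /bsum big_ord0.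
rewrite (_ : bsum h n.+1 = fun x => bsum h n x + h (iter n shift x)).
  by apply: bounded_measurableD => //; exact: bounded_measurable_iter.
by apply/funext => x; exact: bsumSr.
Qed.

Lemma Rintegral_bsum n h : bounded_measurable h ->
  \int[mu]_(x in Sig) bsum h n x = n%:R * \int[mu]_(x in Sig) h x.
Proof.
move=> bh; elim: n => [|n IH].
  rewrite mul0r -(mul0r (fine (mu Sig))) -(Rintegral_cst mu mSig).
  by apply: eq_Rintegral => x _; rewrite /bsum big_ord0.
transitivity (\int[mu]_(x in Sig) (bsum h n x + h (iter n shift x))).
  by apply: eq_Rintegral => x _; rewrite bsumSr.
rewrite RintegralD //; last 2 first.
- exact/bounded_measurable_integrable/bounded_measurable_bsum.
- exact/bounded_measurable_integrable/bounded_measurable_iter.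
by rewrite IH Rintegral_iter // -natr1 mulrDl mul1r.
Qed.

Lemma Rintegral_Sigma_cst c : \int[mu]_(x in Sig) c = c.
Proof. by rewrite Rintegral_cst //= mu_inv.1 mulr1. Qed.

(** Continuity from below along the increasing sets [C m], which exhaust the space. *)
Lemma tight_first_coordinate (d : R) : 0 < d ->
  exists m, \int[mu]_(x in Sig) (\1_[set x : T | (m <= code (x 0%N))%N] x) <= d.
Proof.
move=> d0; pose C m : set T := [set x | (code (x 0%N) < m)%N].
have mC m : measurable (C m).
  by apply: (measurable_open code_inj) => x Cx; exists 1%N => y yx; rewrite /C /= yx.
have UC : \bigcup_m C m = setT.
  by apply/seteqP; split=> // x _; exists (code (x 0%N)).+1 => //=; exact: ltnSn.
have := @nondecreasing_cvg_mu _ _ _ mu C mC; rewrite UC => /(_ measurableT) H.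
have {H} : (mu \o C) n @[n --> \oo] --> mu setT.
  apply: H => m n mn; apply/subsetPset => x Cx; exact: leq_trans Cx mn.
rewrite probability_setT => /fine_cvgP[_ /cvgrPdist_lt /(_ _ d0)] [m _].
move=> /(_ m (leqnn m)) /= Hm; exists m.
pose B : set T := [set x | (m <= code (x 0%N))%N]; rewrite -/B.
have BC : B = ~` C m.
  by apply/seteqP; split=> x; rewrite /B /C /= => H; [apply/negP|move/negP: H]; lia.
have mB : measurable B by rewrite BC; exact: measurableC.
rewrite /Rintegral integral_indic //.
apply: (@le_trans _ _ (fine (mu B))).
  apply: fine_le; rewrite ?fin_num_measure //; first exact: measurableI.
  by apply: le_measure; rewrite ?inE //; exact: measurableI.
rewrite BC probability_setC // fineB ?fin_num_measure //=.
by apply: le_trans (ltW Hm); exact: ler_norm.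
Qed.

End InvariantMeasures.

(** * Integrals are bounded by periodic averages *)

Section IntegralBound.
Context {R : realType} {S : pointedType} (E : S -> S -> Prop) (a : S).
Hypothesis mixE : mixing E.
Variable code : S -> nat.
Hypothesis code_inj : injective code.
Variables (f : (nat -> S) -> R) (W : nat -> R) (M b : R).
Hypothesis fW : modulus E f W.
Hypothesis fM : forall x, Sigma E x -> `|f x| <= M.
Hypothesis fb : forall n z, (0 < n)%N -> periodic_at E a n z ->
  bsum f n z <= n%:R * b.
Local Notation T := (@Omega S).
Local Notation Sig := (Sigma E : set T).

(** By injectivity of [code], raising [m] by one adds at most one state. *)
Lemma walk_lengths_bounded m : exists L, forall s, (code s < m)%N ->
  (exists2 l, (l <= L)%N & walk E a s l) /\ (exists2 l, (l <= L)%N & walk E s a l).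
Proof.
elim: m => [|m [L HL]]; first by exists 0%N.
have [[s0 s0m]|H] := pselect (exists s, code s = m); last first.
  exists L => s; rewrite ltnS leq_eqVlt => /predU1P[sm|/HL//].
  by exfalso; apply: H; exists s.
have [l1 w1] := mixE.1 a s0; have [l2 w2] := mixE.1 s0 a.
exists (maxn L (maxn l1 l2)) => s; rewrite ltnS leq_eqVlt => /predU1P[sm|/HL].
  rewrite (code_inj (etrans sm (esym s0m))).
  by split; [exists l1|exists l2] => //; lia.
by move=> [[l ? ?] [l' ? ?]]; split; [exists l|exists l'] => //; lia.
Qed.

(** Closing costs [W 0] in distortion and, for each of the [l1 + l2] added steps, at most [M] for
    the value of [f] and [|b|] for the longer period. *)
Lemma bsum_le_periodic x n l1 l2 : (0 < n)%N -> Sigma E x ->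
  walk E a (x 0%N) l1 -> walk E (x n) a l2 ->
  bsum f n x <= n%:R * b + (W 0%N + (l1 + l2)%:R * (M + `|b|)).
Proof.
move=> n0 Sx w1 w2; have [z zP zx] := closing n0 Sx w1 w2.
have [Sz _] := zP; pose w := iter l1 shift z.
have Sw : Sigma E w := Sigma_iter l1 Sz.
have /ler_normlP[_ H1] : `|bsum f n x - bsum f n w| <= W 0%N.
  apply: fW.2 => // i; rewrite addn1 ltnS => /zx <-.
  by rewrite /w iter_shiftE addnC.
have := fb _ zP; rewrite !addn_gt0 n0 orbT => /(_ isT).
rewrite -addnA !bsum_cat -/w !natrD => H2.
have /ler_normlP[H3 _] := bsum_bound l1 Sz fM.
have /ler_normlP[H4 _] := bsum_bound l2 (Sigma_iter n Sw) fM.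
have H5 : (l1%:R + l2%:R) * b <= (l1%:R + l2%:R) * `|b|.
  by rewrite ler_wpM2l ?addr_ge0 // ler_norm.
rewrite /w in H1 H2 H4 *; lra.
Qed.

Lemma Rintegral_le_periodic (mu : probability T R) : invariant_probs E mu ->
  \int[mu]_(x in Sig) f x <= b.
Proof.
move=> mu_inv; have [n1 _ [z1 [Sz1 _]]] := mixing_has_periodic a mixE.
have M0 : 0 <= M by apply: le_trans (fM Sz1).
have W0 : 0 <= W 0%N by apply: (modulus_ge0 _ _ fW); exists z1.
have bf : bounded_measurable E (f : T -> R).
  split; last by exists M.
  exact: (measurable_continuous_on code_inj (modulus_continuous fW)).
apply/ler_addgt0Pr => e e0; pose D := M + `|b|.
have D0 : 0 <= D by rewrite addr_ge0.
(* The two ends of a segment will contribute [2 * D * J], with [J] the measure of the bad states;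
   this choice makes it at most [e / 2]. The [+ 1] avoids dividing by zero. *)
have [|m] := @tight_first_coordinate _ _ E _ code_inj mu (e / (4 * (D + 1))).
  by rewrite divr_gt0 //; lra.
pose B : set T := [set x | (m <= code (x 0%N))%N]; rewrite -/B => muB.
have [L HL] := walk_lengths_bounded m.
pose K := W 0%N + (L + L)%:R * D.
(* For such [n] the closing cost [K], independent of [n], is at most [e / 2] per step. *)
have [n [n0 nK]] : exists n, (0 < n)%N /\ 2 * K <= n%:R * e.
  exists (Num.truncn (2 * K / e)).+1; split => //.
  by rewrite -ler_pdivrMr // ltW // truncnS_gt.
(* If both ends are good, the segment can be closed at cost [K]; otherwise an indicator equals 1 and
   the trivial bound [n * M <= n * b + n * D] suffices. *)
have pointwise x : Sig x ->
    bsum f n x <= n%:R * b + K + n%:R * D * (\1_B x + \1_B (iter n shift x)).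
  move=> Sx; have nD : 0 <= n%:R * D by rewrite mulr_ge0.
  have K0 : 0 <= K by rewrite addr_ge0 // mulr_ge0.
  have ind0 y : 0 <= \1_B y :> R by rewrite indicE.
  have [xB|xB] := pselect (B x \/ B (iter n shift x)).
    have H1 : 1 <= \1_B x + \1_B (iter n shift x) :> R.
      case: xB => xB; [have := ind0 (iter n shift x)|have := ind0 x].
        by rewrite [\1_B x]indicE mem_set //=; lra.
      by rewrite [\1_B (iter _ _ _)]indicE mem_set //=; lra.
    have /ler_normlP[_ H2] := bsum_bound n Sx fM.
    have : n%:R * D <= n%:R * D * (\1_B x + \1_B (iter n shift x)).
      by rewrite ler_peMr.
    have : n%:R * - b <= n%:R * `|b| by rewrite ler_wpM2l // -normrN ler_norm.
    by rewrite /D; lra.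
  have [xB1 xB2] : ~ B x /\ ~ B (iter n shift x) by split=> ?; apply: xB; [left|right].
  have [x0 xn] : (code (x 0%N) < m)%N /\ (code (x n) < m)%N.
    split; rewrite ltnNge; apply/negP => // H; apply: xB2.
    by rewrite /B /= iter_shiftE.
  have [[l1 l1L w1] _] := HL _ x0; have [_ [l2 l2L w2]] := HL _ xn.
  apply: le_trans (bsum_le_periodic n0 Sx w1 w2) _.
  rewrite !indicE !memNset //= addr0 mulr0 addr0 lerD2l lerD2l ler_wpM2r //.
  by rewrite ler_nat leq_add.
have mB : measurable B.
  by apply: (measurable_open code_inj) => x Bx; exists 1%N => y yx; rewrite /B /= yx.
have b1 : bounded_measurable E (\1_B : T -> R).
  split; first exact: measurable_funTS.
  by exists 1 => x _; rewrite indicE; case: (x \in B); rewrite ?normr1 ?normr0.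
have b2 := bounded_measurable_iter code_inj n b1.
have mSig := measurable_Sigma E code_inj.
have bi := bounded_measurable_integrable code_inj mu_inv.
have b3 := bounded_measurableZ (n%:R * D) (bounded_measurableD b1 b2).
have b4 := bounded_measurable_cst E (n%:R * b + K).
have := le_Rintegral mSig (bi _ (bounded_measurable_bsum code_inj n bf))
  (bi _ (bounded_measurableD b4 b3)) pointwise.
(* By invariance the left side integrates to [n] times the integral of [f], and both indicators have
   the same integral [J]. *)
rewrite (Rintegral_bsum code_inj mu_inv) // RintegralD ?(bi _ b4) ?(bi _ b3) //.
rewrite (Rintegral_Sigma_cst code_inj mu_inv).
rewrite RintegralZl ?(bi _ (bounded_measurableD b1 b2)) //.
rewrite RintegralD ?(bi _ b1) ?(bi _ b2) //.
rewrite (Rintegral_iter code_inj mu_inv) //.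
set I := Rintegral _ _ _; set J := Rintegral _ _ _ => H.
have DJ : D * J <= e / 4.
  have : (D + 1) * J <= e / 4.
    rewrite mulrC -ler_pdivlMr; last by lra.
    by rewrite -mulrA -invfM.
  have : 0 <= J by apply: Rintegral_ge0 => x _; rewrite indicE.
  by lra.
have n0' : (0 : R) < n%:R by rewrite ltr0n.
rewrite -(ler_pM2l n0').
have : n%:R * (D * J) <= n%:R * (e / 4) by rewrite ler_pM2l.
lra.
Qed.

End IntegralBound.

(** * Invariant measures carried by periodic orbits *)

Section OrbitMeasure.
Context {R : realType} {S : pointedType}.
Local Notation T := (@Omega S).
Variables (z : T) (n : nat).

(** The period is [n.+1], which keeps the normalising factor meaningful; [mscale] and [msum] provide
    the measure structure. *)
Definition orbit_measure : set T -> \bar R :=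
  mscale (n.+1%:R^-1)%:nng
    (msum (fun k => \d_(iter k shift z : T) : {measure set T -> \bar R}) n.+1).

HB.instance Definition _ := Measure.on orbit_measure.

Lemma orbit_measureE A :
  orbit_measure A = (n.+1%:R^-1 * \sum_(k < n.+1) \1_A (iter k shift z : T))%:E.
Proof. by rewrite EFinM -sumEFin. Qed.

Lemma orbit_measure1 (A : set T) : (forall k, A (iter k shift z)) ->
  orbit_measure A = 1%E.
Proof.
move=> Az; rewrite orbit_measureE.
under eq_bigr do rewrite indicE mem_set //.
by rewrite sumr_const card_ord mulVf // pnatr_eq0.
Qed.

Let orbit_measure_setT : orbit_measure setT = 1%E.
Proof. exact: orbit_measure1. Qed.

HB.instance Definition _ :=
  Measure_isProbability.Build _ _ _ orbit_measure orbit_measure_setT.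

End OrbitMeasure.

Section OrbitMeasureInvariance.
Context {R : realType} {S : pointedType} (E : S -> S -> Prop).
Variable code : S -> nat.
Hypothesis code_inj : injective code.
Local Notation T := (@Omega S).
Local Notation Sig := (Sigma E : set T).
Variables (z : T) (n : nat).
Hypothesis Sz : Sigma E z.
Hypothesis pz : iter n.+1 shift z = z.
Local Notation mu := (@orbit_measure R S z n).

(** The shift permutes the Dirac masses cyclically: by periodicity the new last term is the old
    first one. *)
Lemma orbit_measure_invariant : invariant_probs E mu.
Proof.
split; first by apply: orbit_measure1 => k; exact: Sigma_iter.
move=> A mA; apply: etrans (orbit_measureE _ _ _) _.
apply: etrans _ (esym (orbit_measureE _ _ _)).
congr (_ * _)%:E; rewrite [RHS]big_ord_recl [LHS]big_ord_recr /= [LHS]addrC.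
congr (_ + _); by rewrite -{2}pz !indicE.
Qed.

Lemma integral_orbit_measure (f : T -> R) : bounded_measurable E f ->
  \int[mu]_(x in Sig) f x = bsum f n.+1 z / n.+1%:R.
Proof.
move=> bf; have mSig := measurable_Sigma E code_inj.
have mu_inv := orbit_measure_invariant.
have bi := bounded_measurable_integrable code_inj mu_inv.
have [mf [C fC]] := bf; have bC := bounded_measurable_cst E C.
have bfC := bounded_measurableD bf bC.
have fC0 x : Sig x -> 0 <= f x + C.
  by move=> /fC /ler_normlP[]; lra.
(* The rules for scaled measures and sums of measures are applied to a nonnegative integrand, so [f]
   is raised by its bound [C]. *)
suff : \int[mu]_(x in Sig) (f x + C) = bsum f n.+1 z / n.+1%:R + C.
  rewrite RintegralD ?(bi _ bf) ?(bi _ bC) //.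
  by rewrite (Rintegral_Sigma_cst code_inj mu_inv) => /addIr.
have mfC : measurable_fun Sig (fun x => (f x + C)%:E).
  by apply/measurable_EFinP; exact: bfC.1.
rewrite /Rintegral /orbit_measure.
rewrite (ge0_integral_mscale _ mSig) //.
rewrite (ge0_integral_measure_sum _ mSig) //.
rewrite (eq_bigr (fun k : 'I_n.+1 => (f (iter k shift z) + C)%:E)); last first.
  move=> k _; rewrite integral_dirac // diracE mem_set ?mul1e //.
  exact: Sigma_iter.
rewrite sumEFin -EFinM /= big_split /= sumr_const card_ord -/(bsum f n.+1 z).
by rewrite -[C *+ _]mulr_natl mulrDr mulKf ?pnatr_eq0 // mulrC.
Qed.

End OrbitMeasureInvariance.

(** * From the slopes of the pressure function to integrals of [psi] *)

Lemma affine_le_slope {R : realType} (c d q L : R) :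
  (forall t, 0 <= t -> c + t * q <= d + t * L) -> q <= L.
Proof.
move=> H; rewrite leNgt; apply/negP => Lq.
have e0 : 0 < q - L by lra.
(* At this [t] the gain [t * (q - L)] exceeds the initial gap [d - c]. *)
pose t := (`|d - c| + 1) / (q - L).
have t0 : 0 <= t by apply: divr_ge0; [rewrite addr_ge0|exact: ltW].
have tE : t * (q - L) = `|d - c| + 1 by rewrite /t mulfVK // gt_eqF.
by have := H t t0; have := ler_norm (d - c); lra.
Qed.

Lemma lipschitz_continuous {R : realType} (p : R -> R) (M : R) :
  (forall s t, `|p s - p t| <= `|s - t| * M) -> continuous p.
Proof.
move=> lip x; apply/cvgrPdist_lt => e e0.
have M1 : 0 < `|M| + 1 by have := normr_ge0 M; lra.
near=> y; apply: le_lt_trans (lip x y) _.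
apply: (@le_lt_trans _ _ (`|x - y| * (`|M| + 1))).
  by rewrite ler_wpM2l //; have := ler_norm M; lra.
rewrite -ltr_pdivlMr //; near: y; apply: cvgr_dist_lt => //.
by rewrite divr_gt0.
Unshelve. all: by end_near. Qed.

Theorem theorem3p2 (R : realType) (S : pointedType) (E : S -> S -> Prop) (a : S)
    (phi psi : (nat -> S) -> R) :
  countable [set: S] -> mixing E ->
  (PG E (fun _ => 0%R : R) a < +oo)%E ->
  summable_variations E phi -> summable_variations E psi ->
  (exists M : R, forall x, Sigma E x -> phi x <= M) ->
  (exists M : R, forall x, Sigma E x -> `|psi x| <= M) ->
  let p := fun t : R => fine (PG E (fun x => phi x + t * psi x) a) in
  (* (1) *)
  ((forall t : R, PG E (fun x => phi x + t * psi x) a \is a fin_num) /\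
   (forall (x y l : R), 0 <= l <= 1 ->
      p (l * x + (1 - l) * y) <= l * p x + (1 - l) * p y) /\
   continuous p) /\
  (* (2) *)
  exists Dp Dm : R -> R,
    (forall t : R, (fun h => h^-1 * (p (t + h) - p t)) @ 0^'+ --> Dp t) /\
    (forall t : R, (fun h => h^-1 * (p (t + h) - p t)) @ 0^'- --> Dm t) /\
  (* (3) *)
  exists Lp Lm : R,
    Dp t @[t --> +oo] --> Lp /\ Dm t @[t --> +oo] --> Lp /\
    Dp t @[t --> -oo] --> Lm /\ Dm t @[t --> -oo] --> Lm /\
  (* (4) *)
    Lp%:E = ereal_sup (integrals E psi) /\
    Lm%:E = ereal_inf (integrals E psi) /\
  (* (5) *)
    (~ cohomologous_to_const E psi -> Lm < Lp).
Proof.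
move=> cS mixE PG0 _ /summable_variations_modulus[W psiW] [Mphi phiM] [M psiM] p.
have /countable_injP[code code_inj'] := cS.
have code_inj : injective code by move=> s t; apply: code_inj'; rewrite inE.
have pc : convex_fun p := pressure_convex mixE PG0 phiM psiM.
have plip : forall s t, `|p s - p t| <= `|s - t| * M :=
  pressure_lipschitz mixE PG0 phiM psiM.
split.
  split; first exact: (pressure_fin_num mixE PG0 phiM psiM).
  by split; [exact: pc|exact: lipschitz_continuous plip].
have [Dp [Dm [HDp [HDm [Lp [Lm [[L1 L2 L3 L4] [Lp1 Lp2 Lm1 Lm2]]]]]]]] :=
  convex_derivatives pc plip.
exists Dp, Dm; split; first exact: HDp.
split; first exact: HDm.
exists Lp, Lm; do 4 (split => //).
have pge n z t : (0 < n)%N -> periodic_at E a n z ->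
    bsum phi n z / n%:R + t * (bsum psi n z / n%:R) <= p t :=
  @pressure_ge_periodic _ _ _ _ _ _ _ _ mixE PG0 phiM psiM n z t.
have pcmp s t c := @pressure_compare _ _ E a phi psi _ _ mixE PG0 phiM psiM s t c.
(* The line whose slope is the periodic average lies below [p], which lies below a line of slope
   [Lp]. *)
have per_le n z : (0 < n)%N -> periodic_at E a n z -> bsum psi n z <= n%:R * Lp.
  move=> n0 zP; rewrite mulrC -ler_pdivrMr ?ltr0n //.
  apply: (@affine_le_slope _ (bsum phi n z / n%:R) (p 0)) => t t0.
  exact: le_trans (pge n z t n0 zP) (Lp1 t t0).
have per_ge n z : (0 < n)%N -> periodic_at E a n z -> n%:R * Lm <= bsum psi n z.
  move=> n0 zP; rewrite mulrC -ler_pdivlMr ?ltr0n // -lerN2.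
  apply: (@affine_le_slope _ (bsum phi n z / n%:R) (p 0)) => t t0.
  have := le_trans (pge n z (- t) n0 zP) (Lm1 (- t) _).
  by rewrite !mulNr !mulrN; apply; rewrite oppr_le0.
have bpsi : bounded_measurable E (psi : @Omega S -> R).
  split; last by exists M.
  exact: (measurable_continuous_on code_inj (modulus_continuous psiW)).
have intE (mu : probability (@Omega S) R) : invariant_probs E mu ->
    (\int[mu]_(x in (Sigma E : set (@Omega S))) (psi x)%:E =
     (\int[mu]_(x in (Sigma E : set (@Omega S))) psi x)%:E)%E.
  move=> mui; rewrite /Rintegral fineK //; apply: integrable_fin_num => //.
    exact: (measurable_Sigma E code_inj).
  exact: (bounded_measurable_integrable code_inj mui bpsi).
have orbit_integral n z : (0 < n)%N -> periodic_at E a n z ->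
    integrals E psi (bsum psi n z / n%:R)%:E.
  case: n => // n _ [Sz [pz _]]; have mui := orbit_measure_invariant (R := R) Sz pz.
  exists (orbit_measure z n) => //.
  by rewrite intE // (integral_orbit_measure code_inj Sz pz bpsi).
have int_le v : integrals E psi v -> (v <= Lp%:E)%E.
  move=> [mu mui <-]; rewrite intE // lee_fin.
  exact: (Rintegral_le_periodic mixE code_inj psiW psiM per_le mui).
have int_ge v : integrals E psi v -> (Lm%:E <= v)%E.
  (* The lower bound is the upper bound applied to [-psi]. *)
  move=> [mu mui <-]; rewrite intE // lee_fin -lerN2.
  have psiNM x : Sigma E x -> `|- psi x| <= M by rewrite normrN; exact: psiM.
  have -> : - (\int[mu]_(x in (Sigma E : set (@Omega S))) psi x) =
      \int[mu]_(x in (Sigma E : set (@Omega S))) - psi x.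
    rewrite -mulN1r -RintegralZl //; last 2 first.
    - exact: (measurable_Sigma E code_inj).
    - exact: (bounded_measurable_integrable code_inj mui bpsi).
    by apply: eq_Rintegral => x _; rewrite mulN1r.
  apply: (Rintegral_le_periodic (a := a) mixE code_inj (modulusN psiW) psiNM _ mui).
  by move=> n z n0 zP; rewrite bsumN mulrN lerN2; exact: per_ge n0 zP.
have [n0 n0_gt0 [z0 z0P]] := mixing_has_periodic a mixE.
have z0int := orbit_integral _ _ n0_gt0 z0P.
split.
  (* The supremum is real: [Lp] bounds it above and an orbit measure excludes -oo. It bounds all
     periodic averages, so [p] lies below the line of that slope, and minimality of [Lp]
     concludes. *)
  apply/eqP; rewrite eq_le; apply/andP; split; last exact: ge_ereal_sup.
  have : (ereal_sup (integrals E psi) <= Lp%:E)%E by exact: ge_ereal_sup.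
  have ubE := @ereal_sup_ubound _ (integrals E psi).
  move: ubE; case: (ereal_sup _) => [b| |] ubE // _; last first.
    by have := ubE _ z0int; rewrite leeNy_eq.
  rewrite lee_fin; apply: Lp2 => t t0; apply: pcmp => n z n_gt0 zP.
  rewrite subr0 mulrCA ler_wpM2l // mulrC -ler_pdivrMr ?ltr0n //.
  by rewrite -lee_fin; apply: ubE; exact: orbit_integral.
split.
  apply/eqP; rewrite eq_le; apply/andP; split; first exact: le_ereal_inf_tmp.
  have : (Lm%:E <= ereal_inf (integrals E psi))%E by exact: le_ereal_inf_tmp.
  have lbE := @ereal_inf_lbound _ (integrals E psi).
  move: lbE; case: (ereal_inf _) => [b| |] lbE // _; last first.
    by have := lbE _ z0int; rewrite leye_eq.
  rewrite lee_fin; apply: Lm2 => t t0; apply: pcmp => n z n_gt0 zP.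
  rewrite subr0 mulrCA ler_wnM2l // mulrC -ler_pdivlMr ?ltr0n //.
  by rewrite -lee_fin; apply: lbE; exact: orbit_integral.
(* If [Lp <= Lm], every periodic sum is squeezed to exactly [n * Lp]. *)
move=> ncoh; rewrite ltNge; apply/negP => LpLm; apply: ncoh.
apply: (@livsic _ _ E a psi W M Lp) => // n z n_gt0 zP.
apply/eqP; rewrite eq_le per_le //=; apply: le_trans (per_ge n z n_gt0 zP).
by rewrite ler_wpM2l.
Qed.
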